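(* Let $E$ be an $n$-dimensional complex evolution algebra with matrix $A$ in a natural basis. Then $E$ is nilpotent if and only if $A$ can be transformed by a permutation of the natural basis to a strictly upper triangular matrix, i.e. to the form $$\begin{pmatrix}0&a_{12}&a_{13}&\dots&a_{1n}\\0&0&a_{23}&\dots&a_{2n}\\0&0&0&\dots&a_{3n}\\ \vdots&\vdots&\vdots&\ddots&\vdots\\0&0&0&\dots&0\end{pmatrix}.$$ Moreover, the index of nilpotency of a nilpotent $n$-dimensional evolution algebra $E$ is not greater than $2^{n-1}+1$.
   Context: An evolution algebra over a field $K$ is a vector space $E$ over $K$ with a bilinear multiplication and a basis $\{e_1,e_2,\dots\}$ (called a natural basis) such that $e_ie_j=0$ for $i\neq j$ and $e_ie_i=\sum_k a_{ik}e_k$; here $K=\mathbb{C}$. The matrix $A=(a_{ij})_{i,j=1}^n$ is called the matrix of $E$ in the natural basis $\{e_1,\dots,e_n\}$. Put $E^1=E$, $E^k=\sum_{i=1}^{k-1}E^iE^{k-i}$ for $k\ge2$ (products of subspaces are linear spans of products). $E$ is nilpotent if $E^m=0$ for some $m\in\mathbb{N}$, and the minimal such $m$ is the index of nilpotency. *)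

(* Defs.v *)
From HB Require Import structures.
From mathcomp Require Import all_boot all_order all_fingroup all_algebra.
From mathcomp Require Import reals complex.
Set Implicit Arguments.
Unset Strict Implicit.
Unset Printing Implicit Defensive.
Import GRing.Theory.
Local Open Scope ring_scope.

Section EvolutionAlgebra.
Variables (K : fieldType) (E : vectType K).
Implicit Types (mul : {bilinear E -> E -> E}) (U V W : {vspace E}) (k m n : nat).

Definition natural_basis mul n (e : n.-tuple E) : Prop :=
  basis_of fullv e /\ (forall i j : 'I_n, i != j -> mul e`_i e`_j = 0).

(* Row i lists the coordinates of the square of the i-th basis vector. *)
Definition structure_matrix mul n (e : n.-tuple E) : 'M[K]_n :=
  \matrix_(i, j) coord e j (mul e`_i e`_i).

Lemma structure_matrixE mul n (e : n.-tuple E) (i : 'I_n) :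
  natural_basis mul e ->
  mul e`_i e`_i = \sum_(k < n) structure_matrix mul e i k *: e`_k.
Proof.
move=> [be _]; rewrite [LHS](coord_basis be) ?memvf //.
by apply: eq_bigr => k _; rewrite mxE.
Qed.

Definition permute_basis n (s : 'S_n) (e : n.-tuple E) : n.-tuple E :=
  [tuple e`_(s i) | i < n].

(* As for [prodv], spanning by products of basis vectors is enough. *)
Definition mulv mul U V : {vspace E} :=
  <<[seq mul u v | u <- vbasis U, v <- vbasis V]>>%VS.

Lemma memv_mulv mul U V u v : u \in U -> v \in V -> mul u v \in mulv mul U V.
Proof.
move=> Uu Vv; rewrite (coord_vbasis Uu) (coord_vbasis Vv).
rewrite linear_sumlz; apply: memv_suml => i _.
rewrite linearZl_LR memvZ //= linear_sumr; apply: memv_suml => j _.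
rewrite linearZr_LR memvZ //=; apply: memv_span; apply/allpairsP.
exists ((vbasis U)`_i, (vbasis V)`_j); split=> //=;
  by rewrite mem_nth // size_tuple.
Qed.

Lemma mulvP mul U V W :
  reflect (forall u v, u \in U -> v \in V -> mul u v \in W)
          (mulv mul U V <= W)%VS.
Proof.
apply: (iffP idP) => [sW u v Uu Vv | sW].
  by apply: (subvP sW); apply: memv_mulv.
apply/span_subvP=> _ /allpairsP[[u v] /= [Uu Vv ->]].
by apply: sW; apply: vbasis_mem.
Qed.

(* [alg_powers mul k] is the list of E^1, ..., E^k; strong recursion is
   encoded by appending to it E^(k+1), computed from its elements. *)
Fixpoint alg_powers mul k : seq {vspace E} :=
  if k is k'.+1 then
    let s := alg_powers mul k' in
    rcons s (if k' is 0 then fullv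
             else \sum_(1 <= i < k)
                    mulv mul (nth fullv s i.-1) (nth fullv s (k - i).-1))%VS
  else [::].

(* E^k for k >= 1; the value at k = 0 is never used. *)
Definition alg_power mul k : {vspace E} :=
  nth fullv (alg_powers mul k) k.-1.

Lemma size_alg_powers mul k : size (alg_powers mul k) = k.
Proof. by elim: k => //= k IHk; rewrite size_rcons IHk. Qed.

Lemma nth_alg_powers mul k i : (0 < i <= k)%N ->
  nth fullv (alg_powers mul k) i.-1 = alg_power mul i.
Proof.
case/andP=> i_gt0; elim: k => [|k IHk]; first by rewrite leqNgt i_gt0.
rewrite leq_eqVlt => /predU1P[-> // | lt_ik].
by rewrite /= nth_rcons size_alg_powers prednK // -ltnS lt_ik IHk.
Qed.

Lemma alg_power1 mul : alg_power mul 1 = fullv.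
Proof. by []. Qed.

Lemma alg_powerE mul k : (2 <= k)%N ->
  alg_power mul k
    = (\sum_(1 <= i < k) mulv mul (alg_power mul i) (alg_power mul (k - i)))%VS.
Proof.
case: k => [|[|k]] // _.
have -> : alg_power mul k.+2 = (\sum_(1 <= i < k.+2)
    mulv mul (nth fullv (alg_powers mul k.+1) i.-1)
             (nth fullv (alg_powers mul k.+1) (k.+2 - i).-1))%VS.
  rewrite /alg_power; set s := alg_powers mul k.+1.
  have sz_s : size s = k.+1 by rewrite size_alg_powers.
  rewrite -[alg_powers mul k.+2]/(rcons s _) nth_rcons sz_s ltnn eqxx.
  by [].
apply: eq_big_nat => i /andP[i_gt0 i_lt].
rewrite !nth_alg_powers //; last by rewrite i_gt0.
by rewrite subn_gt0 i_lt leq_subLR -add1n leq_add2r.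
Qed.

Definition nilpotent mul : Prop :=
  exists m, (0 < m)%N && (alg_power mul m == 0%VS).

Definition nilpotency_index mul (nilE : nilpotent mul) : nat := ex_minn nilE.

End EvolutionAlgebra.

Definition strictly_upper_triangular (K : fieldType) n (A : 'M[K]_n) : Prop :=
  forall i j : 'I_n, (j <= i)%N -> A i j = 0.

(* Main.v *)
Require Import Defs.
From mathcomp Require Import all_boot all_order all_fingroup all_algebra.
From mathcomp Require Import reals complex.
Set Implicit Arguments.
Unset Strict Implicit.
Import GRing.Theory.
Local Open Scope ring_scope.

(** Triangular matrices give nilpotency together with the bound: number the
    natural basis e_0, ..., e_(n-1) and let V_i be the space of the vectors
    whose first i coordinates vanish. Since e_k e_l = 0 for k != l and e_k e_k
    lies in V_(k+1), every product with a factor in V_i lies in V_(i+1)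
    ([coord_filtration_mulv]). If a + b > 2 ^ i with i > 0, then a or b exceeds
    2 ^ (i - 1); hence, by induction on i, E^k is contained in V_i as soon as
    k > 2 ^ (i - 1), where 0 - 1 is read as 0 ([alg_power_sub_filtration]). As
    V_n = 0, it follows that E^(2 ^ (n - 1) + 1) = 0 ([alg_power_triangular]).

    Conversely, let E^M = 0 and let the depth of i be the largest k <= M such
    that e_i e_i lies in E^k. If the entry (i, j) of the matrix is nonzero, then
    (e_i e_i) e_j is a nonzero multiple of e_j e_j, so e_j e_j lies in E^(k+1)
    whenever e_i e_i lies in E^k ([sqr_alg_powerS]); hence the depth strictly
    increases from i to j ([sqr_depth_lt]). Sorting the basis by depth thus
    makes the matrix strictly upper triangular ([nilpotent_triangular]). *)

(** * Sorting a finite index set by a weight *)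

Lemma exists_sorting_perm {n : nat} (h : 'I_n -> nat) :
  exists s : 'S_n, forall i j : 'I_n, (i <= j)%N -> (h (s i) <= h (s j))%N.
Proof.
pose r := relpre h leq; pose t := ord_tuple n.
have /tuple_permP[s sE] : perm_eq (sort r t) t by rewrite perm_sort.
have r_trans : transitive r by move=> x y z; apply: leq_trans.
have : sorted r (sort r t) by apply: sort_sorted => x y; apply: leq_total.
rewrite sE => /(sorted_leq_nth r_trans (fun x => leqnn (h x))) s_sorted.
exists s => i j le_ij.
have := s_sorted i i j; rewrite !inE size_tuple !ltn_ord => /(_ isT isT le_ij).
by rewrite -!tnth_nth !tnth_mktuple !tnth_ord_tuple.
Qed.

(** * Powers of an algebra *)

Section Powers.

Context {K : fieldType} {E : vectType K}.
Variable mul : {bilinear E -> E -> E}.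

Lemma alg_power_sub (k : nat) (W : {vspace E}) : (2 <= k)%N ->
  (forall i, (0 < i < k)%N ->
     (mulv mul (alg_power mul i) (alg_power mul (k - i)) <= W)%VS) ->
  (alg_power mul k <= W)%VS.
Proof.
move=> k_ge2 sW; rewrite alg_powerE // big_nat.
by elim/big_ind: _ => [|U V sU sV|]; rewrite ?sub0v ?subv_add ?sU.
Qed.

Lemma mem_mul_alg_power (k : nat) (u v : E) : (0 < k)%N ->
  u \in alg_power mul k -> mul u v \in alg_power mul k.+1.
Proof.
move=> k_gt0 Eku; rewrite alg_powerE // big_nat_recr //= subSnn alg_power1.
by apply: (subvP (addvSr _ _)); apply: memv_mulv; rewrite ?memvf.
Qed.

End Powers.

(** * Algebras with a natural basis *)

Section NaturalBasis.

Context {K : fieldType} {E : vectType K} {n : nat}.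
Variables (mul : {bilinear E -> E -> E}) (e : n.-tuple E).

Lemma nth_permute_basis (s : 'S_n) (i : 'I_n) :
  (permute_basis s e)`_i = e`_(s i).
Proof. by rewrite -tnth_nth tnth_mktuple. Qed.

Lemma permute_basis_basis (s : 'S_n) :
  basis_of fullv e -> basis_of fullv (permute_basis s e).
Proof.
rewrite (@perm_basis _ _ (permute_basis s e) e) //; apply/tuple_permP.
exists s; congr (tval _); apply: eq_from_tnth => i.
by rewrite !tnth_mktuple (tnth_nth 0).
Qed.

Lemma coord_permute_basis (s : 'S_n) (i : 'I_n) (v : E) :
  basis_of fullv e -> coord (permute_basis s e) i v = coord e (s i) v.
Proof.
move=> e_basis; rewrite {1}(coord_basis e_basis (memvf v)).
rewrite (reindex_inj (@perm_inj _ s)) /=.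
under eq_bigr => j _ do rewrite -nth_permute_basis.
by rewrite coord_sum_free // (basis_free (permute_basis_basis s e_basis)).
Qed.

Lemma structure_matrix_permute (s : 'S_n) (i j : 'I_n) :
  basis_of fullv e ->
  structure_matrix mul (permute_basis s e) i j
    = structure_matrix mul e (s i) (s j).
Proof. by move=> e_basis; rewrite !mxE nth_permute_basis coord_permute_basis. Qed.

Lemma natural_basis_permute (s : 'S_n) :
  natural_basis mul e -> natural_basis mul (permute_basis s e).
Proof.
move=> [e_basis e_orth]; split=> [|i j neq_ij].
  exact: permute_basis_basis.
by rewrite !nth_permute_basis e_orth // (inj_eq perm_inj).
Qed.

Section Products.

Hypothesis natural_e : natural_basis mul e.

Lemma mul_natural_basisr (u : E) (j : 'I_n) :
  mul u e`_j = coord e j u *: mul e`_j e`_j.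
Proof.
have [e_basis e_orth] := natural_e.
rewrite {1}(coord_basis e_basis (memvf u)) linear_sumlz (bigD1 j) //=.
rewrite linearZl_LR big1 ?addr0 // => k neq_kj.
by rewrite linearZl_LR /= e_orth // scaler0.
Qed.

Lemma coord_mul (u v : E) (j : 'I_n) :
  coord e j (mul u v)
    = \sum_(k < n) coord e k u * coord e k v * structure_matrix mul e k j.
Proof.
rewrite {1}(coord_basis (proj1 natural_e) (memvf v)) linear_sumr linear_sum.
apply: eq_bigr => k _; rewrite linearZr_LR /= mul_natural_basisr mxE.
by rewrite !linearZ /= mulrA [_ * coord e k v]mulrC.
Qed.

End Products.

(** * The coordinate filtration and triangular matrices *)

(** The vectors whose first i coordinates vanish, as an intersection of kernels
    of coordinate forms. *)
Definition coord_filtration (i : nat) : {vspace E} :=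
  (\bigcap_(j < n | (j < i)%N) lker (linfun (coord e j : E -> K^o)))%VS.

Lemma coord_filtrationP (i : nat) (u : E) :
  reflect (forall j : 'I_n, (j < i)%N -> coord e j u = 0)
          (u \in coord_filtration i).
Proof.
rewrite memvE; apply: (iffP subv_bigcapP) => u0 j lt_ji.
  by have := u0 j lt_ji; rewrite -memvE memv_ker lfunE => /eqP.
by rewrite -memvE memv_ker lfunE /= u0.
Qed.

Lemma coord_filtration_full : basis_of fullv e -> coord_filtration n = 0%VS.
Proof.
move=> e_basis; apply/eqP; rewrite -subv0; apply/subvP=> u /coord_filtrationP u0.
rewrite memv0 (coord_basis e_basis (memvf u)) big1 // => j _.
by rewrite u0 ?scale0r.
Qed.

Section Triangular.

Hypotheses (natural_e : natural_basis mul e)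
  (triangular_e : strictly_upper_triangular (structure_matrix mul e)).

Lemma coord_filtration_mulv (i : nat) (U V : {vspace E}) :
  (U <= coord_filtration i)%VS || (V <= coord_filtration i)%VS ->
  (mulv mul U V <= coord_filtration i.+1)%VS.
Proof.
move=> sUV; apply/mulvP=> u v Uu Vv; apply/coord_filtrationP=> j lt_ji.
rewrite coord_mul // big1 // => k _.
(* The k-th term has the factor (k, j) of a triangular matrix if i <= k, and the
   k-th coordinate of an element of V_i otherwise. *)
have [lt_ki|le_ik] := ltnP k i; last first.
  by rewrite triangular_e ?mulr0 // (leq_trans _ le_ik).
case/orP: sUV => [/subvP/(_ u Uu)|/subvP/(_ v Vv)] /coord_filtrationP -> //.
  by rewrite !mul0r.
by rewrite mulr0 mul0r.
Qed.

Lemma alg_power_sub_filtration (i k : nat) : (2 ^ i.-1 < k)%N ->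
  (alg_power mul k <= coord_filtration i)%VS.
Proof.
elim: i k => [|i IHi] k lt_ik; first by apply/subvP=> u _; apply/coord_filtrationP.
apply: alg_power_sub => [|a /andP[a_gt0 lt_ak]].
  by rewrite (leq_trans _ lt_ik) // ltnS expn_gt0.
case: i => [|i] in IHi lt_ik *.
  (* Every product lies in V_1, because V_0 is the whole space. *)
  apply: coord_filtration_mulv; apply/orP; left.
  by apply/subvP=> u _; apply/coord_filtrationP.
apply: coord_filtration_mulv; have [lt_ia|le_ai] := ltnP (2 ^ i) a.
  by rewrite IHi.
rewrite [X in _ || X]IHi ?orbT //.
rewrite ltn_subRL; apply: leq_ltn_trans lt_ik.
by rewrite expnS mul2n -addnn leq_add2r.
Qed.

Lemma alg_power_triangular : alg_power mul (2 ^ n.-1 + 1) = 0%VS.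
Proof.
apply/eqP; rewrite -subv0 -(coord_filtration_full (proj1 natural_e)).
by rewrite alg_power_sub_filtration // addn1.
Qed.

End Triangular.

(** * Sorting the basis of a nilpotent algebra *)

(** The largest k <= M such that the square of the i-th basis vector lies in
    E^k. The cutoff M matters when this square is zero, as it then lies in every
    E^k. The index k = 0, where E^k has no meaning, contributes 0 and does not
    affect the maximum. *)
Definition sqr_depth (M : nat) (i : 'I_n) : nat :=
  \max_(k < M.+1 | mul e`_i e`_i \in alg_power mul k) k.

Section Depth.

Hypothesis natural_e : natural_basis mul e.

Lemma sqr_alg_powerS (k : nat) (i j : 'I_n) : (0 < k)%N ->
  structure_matrix mul e i j != 0 ->
  mul e`_i e`_i \in alg_power mul k -> mul e`_j e`_j \in alg_power mul k.+1.
Proof.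
move=> k_gt0 nz_ij /(mem_mul_alg_power e`_j k_gt0).
rewrite mxE in nz_ij.
by rewrite (mul_natural_basisr natural_e) rpredZeq (negPf nz_ij).
Qed.

Lemma sqr_depth_lt (M : nat) (i j : 'I_n) : (0 < M)%N ->
  alg_power mul M = 0%VS -> structure_matrix mul e i j != 0 ->
  (sqr_depth M i < sqr_depth M j)%N.
Proof.
move=> M_gt0 EM0 nz_ij.
pose P (k : 'I_M.+1) := mul e`_i e`_i \in alg_power mul k.
have P1 : P (inord 1) by rewrite /P inordK // memvf.
rewrite /sqr_depth (bigmax_eq_arg (inord 1) P1).
case: arg_maxnP => //= k Pk max_k.
have k_gt0 : (0 < k)%N by have := max_k _ P1; rewrite /= inordK.
(* k = M would give e_i e_i = 0, and row i of the matrix would vanish. *)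
have lt_kM : (k < M)%N.
  rewrite ltn_neqAle -ltnS ltn_ord andbT; apply: contra_neqN nz_ij => /eqP kM.
  by move: Pk; rewrite /P kM EM0 memv0 mxE => /eqP->; rewrite linear0.
have ltSk : (k.+1 < M.+1)%N by [].
by apply: (bigmax_sup (Ordinal ltSk)); first exact: (sqr_alg_powerS k_gt0 nz_ij).
Qed.

Lemma nilpotent_triangular : nilpotent mul ->
  exists s : 'S_n,
    strictly_upper_triangular (structure_matrix mul (permute_basis s e)).
Proof.
case=> M /andP[M_gt0 /eqP EM0].
have [s s_sorted] := exists_sorting_perm (sqr_depth M).
exists s => i j le_ji; rewrite structure_matrix_permute; last by case: natural_e.
apply/eqP; apply: contraTT (s_sorted j i le_ji) => nz_ij.
by rewrite -ltnNge sqr_depth_lt.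
Qed.

End Depth.

End NaturalBasis.

Theorem theorem4p5 (R : realType) (n : nat) (E : vectType R[i])
    (mul : {bilinear E -> E -> E}) (e : n.-tuple E)
    (natural_e : natural_basis mul e) :
  (nilpotent mul <->
     exists s : 'S_n,
       strictly_upper_triangular (structure_matrix mul (permute_basis s e))) /\
  (forall nilE : nilpotent mul, (nilpotency_index nilE <= 2 ^ n.-1 + 1)%N).
Proof.
have power0 (s : 'S_n) :
    strictly_upper_triangular (structure_matrix mul (permute_basis s e)) ->
    (0 < 2 ^ n.-1 + 1)%N && (alg_power mul (2 ^ n.-1 + 1) == 0%VS).
  move/(alg_power_triangular (natural_basis_permute s natural_e)) => ->.
  by rewrite addn1 eqxx.
split=> [|nilE].
  split; first exact: nilpotent_triangular.
  by case=> s /power0; exists (2 ^ n.-1 + 1)%N.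
have [s /power0 pow0] := nilpotent_triangular natural_e nilE.
by rewrite /nilpotency_index; case: ex_minnP => m _; apply.
Qed.
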